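(* Let $\upsilon^*=\min\{f(X): X\in\mathcal F\}$ be the optimal value of the binary program (in minimization form), and let $V^{l_f}$ be a normal output of Algorithm 1 (described in the context), where for each $l\ge0$ the sequence $\{(V^{l,k},\Gamma^{l,k})\}_{k\ge0}$ is generated by Algorithm A with penalty parameter $\rho=\rho_l$, starting point $V^{l,0}=V^l$ and $\beta_k\equiv0$, and the iterate $V^{l+1}$ is the limit of $\{V^{l,k}\}_{k\ge0}$. If there exists $l^*\in\{0,1,\dots,l_f\}$ such that $f((V^{l^*})^{\mathbb T}V^{l^*})\le\upsilon^*$, then, with $r^*=\mathrm{rank}(V^{l^*})$ and $x^{l_f}=\|V^{l_f}\|P_1$ for $P\in\mathbb{O}((V^{l_f})^{\mathbb T}V^{l_f})$, $$f\big(x^{l_f}(x^{l_f})^{\mathbb T}\big)-\upsilon^*\le\rho_{l_f}\|V^{l_f}\|^2-\rho_{l^*}\frac{p}{r^*}+\sum_{j=l^*}^{l_f-1}(\rho_j-\rho_{j+1})\|V^{j+1}\|^2+\alpha_f\epsilon$$ and $$\|x^{l_f}\circ x^{l_f}-e\|\le\epsilon .$$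
   Context: Notation. $\mathbb{S}^p$ is the space of real symmetric $p\times p$ matrices, $\mathbb{S}^p_+$ the positive semidefinite ones, $\langle\cdot,\cdot\rangle$ the trace inner product, $\|\cdot\|_F$ the Frobenius norm, $\|\cdot\|$ the spectral norm of a matrix (Euclidean norm of a vector), $e$ the all-ones vector, $\circ$ the entrywise product, $m$ an integer with $1<m<p$. For $X\in\mathbb{S}^p$ with eigenvalues $\lambda_1(X)\ge\dots\ge\lambda_p(X)$, $\mathbb{O}(X)$ is the set of orthogonal $P$ with $X=P\,\mathrm{Diag}(\lambda_1(X),\dots,\lambda_p(X))P^{\mathbb T}$; $P_1$ is the first column of $P$. Setting. $\Omega=\{X\in\mathbb{S}^p_+:\mathrm{diag}(X)=e\}$ and $\mathcal F=\{X\in\Omega:\mathrm{rank}(X)\le1\}=\{zz^{\mathbb T}: z\in\{-1,1\}^p\}$. The unconstrained binary polynomial program is reformulated as minimizing $f$ over $\mathcal F$, where $f:\mathbb{S}^p\to\mathbb{R}$ is smooth with gradient Lipschitz continuous on a compact set containing $(1+\tau)\Omega-\tau\Omega$ for all $\tau\in[0,1]$. $\alpha_f>0$ is the Lipschitz constant (Frobenius norm) of $f$ on $\Omega$. Put $\tilde f(V)=f(V^{\mathbb T}V)$, $\tilde\psi(V)=-\|V\|^2$ for $V\in\mathbb{R}^{m\times p}$, and $\mathcal S=\{V\in\mathbb{R}^{m\times p}:\|V_j\|=1,\ j=1,\dots,p\}$ ($V_j$ the $j$th column). $\mathbb{B}_{\mathcal S}$ is a compact set containing $(1+\tau)\mathcal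 S-\tau\mathcal S$ for all $\tau\in[0,1]$, and $L_{\tilde f}>0$ is the Lipschitz constant of $\nabla\tilde f$ on $\mathbb{B}_{\mathcal S}$, for which $|\tilde f(V)-\tilde f(Z)-\langle\nabla\tilde f(Z),V-Z\rangle|\le\frac{L_{\tilde f}}2\|V-Z\|_F^2$ for all $V,Z\in\mathbb{B}_{\mathcal S}$. Algorithm A with $\beta_k\equiv0$, parameter $\rho$ and start $V^0\in\mathcal S$: with $L_0\ge\underline L>L_{\tilde f}$ and $L_k\in[\underline L,L_0]$, for $k=0,1,\dots$ let $\Gamma^k=-2V^kP^k_1(P^k_1)^{\mathbb T}$ for some $P^k\in\mathbb{O}((V^k)^{\mathbb T}V^k)$ and choose $V^{k+1}\in\arg\min_{V\in\mathcal S}\{\langle\nabla\tilde f(V^k)+\rho\Gamma^k,V\rangle+\rho\|V\|_F^2+\frac{L_k}{2}\|V-V^k\|_F^2\}$. Algorithm 1. Choose a small $\epsilon\in(0,1)$, $l_{\max}\in\mathbb{N}$ and $\rho_{\max}>0$ appropriately large, $\rho_0>0$, $\sigma>1$, $V^0\in\mathcal S$. For $l=0,1,\dots,l_{\max}$: starting from $V^l$, compute a critical point $V^{l+1}$ of $\min_{V\in\mathcal S}\{\tilde f(V)+\rho_l(\|V\|_F^2+\tilde\psi(V))\}$ (here by Algorithm A with $\rho=\rho_l$); if $\|V^{l+1}\|_F^2-\|V^{l+1}\|^2\le\epsilon$, stop; the penalty parameters satisfy $\rho_{l+1}=\min\{\sigma\rho_l,\rho_{\max}\}$. The algorithm exits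 normally if it stops through this test at some $l<l_{\max}$; the normal output is the last computed iterate, denoted $V^{l_f}$, so $\|V^{l_f}\|_F^2-\|V^{l_f}\|^2\le\epsilon$.
   Formalization: The constant α_f is taken to be a Lipschitz constant of f on Ω together with all matrices xxᵀ with x=‖V‖P₁, V∈S, P∈O(VᵀV), not on Ω alone, since xxᵀ generally lies outside Ω and the stated bound then fails. *)

(* Defs.v *)
From HB Require Import structures.
From mathcomp Require Import all_boot all_order all_algebra.
From mathcomp Require Import all_classical all_reals all_analysis.

Set Implicit Arguments.
Unset Strict Implicit.
Unset Printing Implicit Defensive.

Import Order.TTheory GRing.Theory Num.Theory.
Import numFieldNormedType.Exports.

Local Open Scope classical_set_scope.
Local Open Scope ring_scope.

(* The library norm of a matrix is the entrywise maximum, so the Euclidean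
   norms are defined here; on a column vector, fnorm is the Euclidean norm. *)
Definition inner (R : realType) (m n : nat) (A B : 'M[R]_(m, n)) : R :=
  \tr (A^T *m B).

Definition fnorm (R : realType) (m n : nat) (A : 'M[R]_(m, n)) : R :=
  Num.sqrt (inner A A).

Definition specnorm (R : realType) (m n : nat) (A : 'M[R]_(m, n)) : R :=
  sup [set fnorm (A *m u) | u in [set u : 'cV[R]_n | fnorm u <= 1]].

(* The gradient for the trace inner product; meaningful where g is
   differentiable. *)
Definition grad (R : realType) (m n : nat) (g : 'M[R]_(m, n) -> R)
    (X : 'M[R]_(m, n)) : 'M[R]_(m, n) :=
  \matrix_(i, j) 'd g X (delta_mx i j).

Definition lipschitz_scalar (R : realType) (m n : nat) (a : R)
    (A : set 'M[R]_(m, n)) (g : 'M[R]_(m, n) -> R) : Prop :=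
  forall X Y, A X -> A Y -> `|g X - g Y| <= a * fnorm (X - Y).

Definition lipschitz_mx (R : realType) (m n : nat) (L : R)
    (A : set 'M[R]_(m, n)) (G : 'M[R]_(m, n) -> 'M[R]_(m, n)) : Prop :=
  forall X Y, A X -> A Y -> fnorm (G X - G Y) <= L * fnorm (X - Y).

(* Contains (1 + tau) A - tau A (Minkowski operations) for tau in [0, 1]. *)
Definition contains_extrapolations (R : realType) (m n : nat)
    (B A : set 'M[R]_(m, n)) : Prop :=
  forall tau X Y, 0 <= tau <= 1 -> A X -> A Y ->
    B ((1 + tau) *: X - tau *: Y).

Definition argmin (T : Type) (R : realType) (A : set T) (q : T -> R) : set T :=
  [set x | A x /\ forall y, A y -> q x <= q y].

Definition Sym (R : realType) (p : nat) : set 'M[R]_p :=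
  [set X | X^T = X].

Definition Psd (R : realType) (p : nat) : set 'M[R]_p :=
  [set X | Sym X /\ forall u : 'cV[R]_p, 0 <= inner u (X *m u)].

Definition Omega (R : realType) (p : nat) : set 'M[R]_p :=
  [set X | Psd X /\ forall i, X i i = 1].

Definition Feas (R : realType) (p : nat) : set 'M[R]_p :=
  [set X | Omega X /\ (\rank X <= 1)%N].

(* A function on symmetric matrices is represented by a function on all square
   matrices of which only the values on Sym matter.  Precomposing with the
   orthogonal projection onto Sym turns its differentiability, and its gradient
   at a symmetric matrix, into the ones relative to the Euclidean space Sym. *)
Definition on_sym (R : realType) (p : nat) (f : 'M[R]_p -> R)
    (X : 'M[R]_p) : R := f (2^-1 *: (X + X^T)).

Definition smooth_on_sym (R : realType) (p : nat) (f : 'M[R]_p -> R) : Prop :=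
  (forall X, differentiable (on_sym f) X) /\ continuous (grad (on_sym f)).

(* d lists the eigenvalues of X with multiplicity, in nonincreasing order. *)
Definition is_eigenvalues (R : realType) (p : nat) (X : 'M[R]_p)
    (d : 'rV[R]_p) : Prop :=
  (forall i j : 'I_p, (i <= j)%N -> d 0 j <= d 0 i) /\
  char_poly X = \prod_(i < p) ('X - (d 0 i)%:P).

Definition Ortho (R : realType) (p : nat) (X : 'M[R]_p) : set 'M[R]_p :=
  [set P | P *m P^T = 1%:M /\
     exists2 d : 'rV[R]_p, is_eigenvalues X d & X = P *m diag_mx d *m P^T].

Definition Sphere (R : realType) (m p : nat) : set 'M[R]_(m, p) :=
  [set V | forall j, fnorm (col j V) = 1].

Definition factored (R : realType) (m p : nat) (f : 'M[R]_p -> R)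
    (V : 'M[R]_(m, p)) : R := f (V^T *m V).

(* In what follows the number of columns is n.+1, so that col 0 P is the first
   column of P. *)
Definition rounding (R : realType) (m n : nat) (V : 'M[R]_(m, n.+1))
    (P : 'M[R]_n.+1) : 'cV[R]_n.+1 := specnorm V *: col 0 P.

(* The matrices x x^T obtained by rounding some V in Sphere.  Their diagonal is
   in general not the all-ones vector, so they need not belong to Omega. *)
Definition Rounded (R : realType) (m n : nat) : set 'M[R]_n.+1 :=
  [set X | exists (V : 'M[R]_(m, n.+1)) (P : 'M[R]_n.+1),
     [/\ Sphere V, Ortho (V^T *m V) P &
         X = rounding V P *m (rounding V P)^T]].

(* V and G (for Gamma) are generated by the proximal algorithm without
   extrapolation for ft + rho (|.|_F^2 - |.|^2) on Sphere, started at V0, where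
   Lft is the Lipschitz constant of the gradient of ft. *)
Definition algorithmA (R : realType) (m n : nat) (ft : 'M[R]_(m, n.+1) -> R)
    (Lft rho : R) (V0 : 'M[R]_(m, n.+1)) (V G : nat -> 'M[R]_(m, n.+1)) : Prop :=
  exists (Llow : R) (L : nat -> R),
  [/\ Lft < Llow, forall k, Llow <= L k <= L 0%N, Sphere V0, V 0%N = V0 &
      forall k,
        (exists2 P, Ortho ((V k)^T *m V k) P &
                    G k = - 2 *: (V k *m col 0 P *m (col 0 P)^T)) /\
        argmin (@Sphere R m n.+1)
          (fun W => inner (grad ft (V k) + rho *: G k) W
                    + rho * fnorm W ^+ 2 + L k / 2 * fnorm (W - V k) ^+ 2)
          (V k.+1)].

Definition penalties (R : realType) (rho0 sigma rhomax : R)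
    (rho : nat -> R) : Prop :=
  rho 0%N = rho0 /\ forall l, rho l.+1 = Num.min (sigma * rho l) rhomax.

Definition rank1_gap (R : realType) (m p : nat) (V : 'M[R]_(m, p)) : R :=
  fnorm V ^+ 2 - specnorm V ^+ 2.

(* A normal run with output V lf: the stopping test is applied to V l.+1 in
   pass l and succeeds for the first time in pass lf.-1 < lmax.  VV l and GG l
   are the inner sequences of pass l; the values of V, VV and GG at later
   indices are irrelevant. *)
Definition algorithm1_normal (R : realType) (m n : nat)
    (ft : 'M[R]_(m, n.+1) -> R) (Lft eps : R) (lmax : nat) (rho : nat -> R)
    (V : nat -> 'M[R]_(m, n.+1)) (VV GG : nat -> nat -> 'M[R]_(m, n.+1))
    (lf : nat) : Prop :=
  [/\ (0 < lf <= lmax)%N,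
      Sphere (V 0%N),
      forall l, (l < lf)%N ->
        algorithmA ft Lft (rho l) (V l) (VV l) (GG l) /\
        (VV l k @[k --> \oo] --> V l.+1),
      forall l, (0 < l < lf)%N -> eps < rank1_gap (V l) &
      rank1_gap (V lf) <= eps].

(* Main.v *)
(* Since |V|_F^2 = p on the sphere, the penalty only enters through
   rho |V|^2.  The step of Algorithm A minimizes a majorant of
   ft - rho |.|^2 built from the descent lemma for ft and the convexity of
   |.|^2, so this function decreases along the inner iterates, and, being
   Lipschitz in V^T V, also from V^l to V^(l+1).  Summing by parts over
   l = l*, ..., l_f - 1 and bounding |V^(l* )|^2 below by p / r* (the trace
   p of V^T V is at most rank times the largest eigenvalue) gives the
   estimate for f (V^T V) at V = V^(l_f).  Rounding replaces V^T V by its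
   leading rank-one part; the error has Frobenius norm at most the sum of the
   remaining eigenvalues, that is, |V|_F^2 - |V|^2 <= eps. *)
Require Import Defs.
From HB Require Import structures.
From mathcomp Require Import all_boot all_order all_algebra.
From mathcomp Require Import all_classical all_reals all_analysis.
From mathcomp Require Import ring lra.
Import Order.TTheory GRing.Theory Num.Theory.
Import numFieldNormedType.Exports.
Local Open Scope classical_set_scope.
Local Open Scope ring_scope.

Set Implicit Arguments.
Unset Strict Implicit.
Unset Printing Implicit Defensive.

(** * Trace inner product and Frobenius norm *)

Lemma innerE (R : realType) m n (A B : 'M[R]_(m, n)) :
  inner A B = \sum_i \sum_j A i j * B i j.
Proof.
rewrite /inner /mxtrace exchange_big /=; apply: eq_bigr => j _.
by rewrite mxE; apply: eq_bigr => i _; rewrite mxE.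
Qed.

Lemma innerC (R : realType) m n (A B : 'M[R]_(m, n)) : inner A B = inner B A.
Proof. by rewrite /inner -mxtrace_tr trmx_mul trmxK. Qed.

Lemma innerDr (R : realType) m n (A B C : 'M[R]_(m, n)) :
  inner A (B + C) = inner A B + inner A C.
Proof. by rewrite /inner mulmxDr linearD. Qed.

Lemma innerZr (R : realType) m n c (A B : 'M[R]_(m, n)) :
  inner A (c *: B) = c * inner A B.
Proof. by rewrite /inner -scalemxAr linearZ. Qed.

Lemma innerBr (R : realType) m n (A B C : 'M[R]_(m, n)) :
  inner A (B - C) = inner A B - inner A C.
Proof. by rewrite innerDr -scaleN1r innerZr mulN1r. Qed.

Lemma innerDl (R : realType) m n (A B C : 'M[R]_(m, n)) :
  inner (A + B) C = inner A C + inner B C.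
Proof. by rewrite innerC innerDr !(innerC C). Qed.

Lemma innerZl (R : realType) m n c (A B : 'M[R]_(m, n)) :
  inner (c *: A) B = c * inner A B.
Proof. by rewrite innerC innerZr innerC. Qed.

Lemma innerBl (R : realType) m n (A B C : 'M[R]_(m, n)) :
  inner (A - B) C = inner A C - inner B C.
Proof. by rewrite innerC innerBr !(innerC C). Qed.

Lemma inner_mull (R : realType) m n p (A : 'M[R]_(m, n)) (B : 'M[R]_(n, p)) C :
  inner (A *m B) C = inner B (A^T *m C).
Proof. by rewrite /inner trmx_mul mulmxA. Qed.

Lemma inner_mulr (R : realType) m n p (A : 'M[R]_(m, n)) (B : 'M[R]_(n, p)) C :
  inner (A *m B) C = inner A (C *m B^T).
Proof. by rewrite /inner trmx_mul -mulmxA mxtrace_mulC mulmxA. Qed.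

Lemma inner_ge0 (R : realType) m n (A : 'M[R]_(m, n)) : 0 <= inner A A.
Proof.
rewrite innerE; apply: sumr_ge0 => i _; apply: sumr_ge0 => j _.
by rewrite -expr2 sqr_ge0.
Qed.

Lemma fnorm_sq (R : realType) m n (A : 'M[R]_(m, n)) : fnorm A ^+ 2 = inner A A.
Proof. by rewrite sqr_sqrtr // inner_ge0. Qed.

Lemma fnorm_ge0 (R : realType) m n (A : 'M[R]_(m, n)) : 0 <= fnorm A.
Proof. exact: sqrtr_ge0. Qed.

Lemma fnormN (R : realType) m n (A : 'M[R]_(m, n)) : fnorm (- A) = fnorm A.
Proof. by rewrite /fnorm -scaleN1r innerZr innerZl mulrA mulrNN !mul1r. Qed.

Lemma fnorm0 (R : realType) m n : fnorm (0 : 'M[R]_(m, n)) = 0.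
Proof. by rewrite /fnorm -(scale0r 0) innerZl mul0r sqrtr0. Qed.

Lemma fnorm0_eq0 (R : realType) m n (A : 'M[R]_(m, n)) : fnorm A = 0 -> A = 0.
Proof.
move=> A0; have := fnorm_sq A; rewrite A0 expr0n /= innerE => /esym/eqP.
rewrite psumr_eq0 => [/allP h|i _]; last first.
  by apply: sumr_ge0 => j _; rewrite -expr2 sqr_ge0.
apply/matrixP => i j; have := h i (mem_index_enum i).
rewrite /= psumr_eq0 => [/allP/(_ j (mem_index_enum j))|k _]; last first.
  by rewrite -expr2 sqr_ge0.
by rewrite /= -expr2 sqrf_eq0 mxE => /eqP.
Qed.

(** Cauchy-Schwarz: expanding the squared norm of [fnorm B *: A - fnorm A *: B] gives
    [2 |A| |B| (|A| |B| - <A, B>) >= 0], and [|A| |B|] cancels once both norms are nonzero. *)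
Lemma inner_le_fnorm (R : realType) m n (A B : 'M[R]_(m, n)) :
  inner A B <= fnorm A * fnorm B.
Proof.
have [B0|B_neq0] := eqVneq (fnorm B) 0.
  by rewrite B0 mulr0 (fnorm0_eq0 B0) -(scale0r 0) innerZr mul0r.
have [A0|A_neq0] := eqVneq (fnorm A) 0.
  by rewrite A0 mul0r (fnorm0_eq0 A0) -(scale0r 0) innerZl mul0r.
have A_gt0 : 0 < fnorm A by rewrite lt_def A_neq0 fnorm_ge0.
have B_gt0 : 0 < fnorm B by rewrite lt_def B_neq0 fnorm_ge0.
have := inner_ge0 (fnorm B *: A - fnorm A *: B).
rewrite innerBl !innerBr !innerZl !innerZr (innerC B A) -!fnorm_sq => h.
have AB_gt0 : 0 < fnorm A * fnorm B by rewrite mulr_gt0.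
rewrite -subr_ge0 -(pmulr_rge0 _ AB_gt0); nra.
Qed.

(** * Gram matrices of points of the sphere *)

Lemma gram_diag (R : realType) m p (V : 'M[R]_(m, p)) j :
  (V^T *m V) j j = fnorm (col j V) ^+ 2.
Proof.
rewrite fnorm_sq innerE mxE; apply: eq_bigr => i _.
by rewrite big_ord1 !mxE.
Qed.

Lemma sphere_diag (R : realType) m p (V : 'M[R]_(m, p)) :
  Sphere V <-> forall j, (V^T *m V) j j = 1.
Proof.
split=> hV j; first by rewrite gram_diag hV expr1n.
by apply/eqP; rewrite -sqrp_eq1 ?fnorm_ge0// -gram_diag hV.
Qed.

Lemma sphere_fnorm (R : realType) m p (V : 'M[R]_(m, p)) :
  Sphere V -> fnorm V ^+ 2 = p%:R.
Proof.
move=> /sphere_diag hV; rewrite fnorm_sq /inner /mxtrace.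
by under eq_bigr do rewrite hV; rewrite sumr_const card_ord.
Qed.

Lemma sphere_Omega (R : realType) m p (V : 'M[R]_(m, p)) :
  Sphere V -> Omega (V^T *m V).
Proof.
move=> /sphere_diag hV; split=> //; split=> [|u].
  by rewrite /Sym /= trmx_mul trmxK.
by rewrite -mulmxA innerC inner_mull trmxK inner_ge0.
Qed.

(** * Spectral decomposition of [V^T *m V] and its rank-one part *)

Lemma rank_diag_ge (R : realType) p (d : 'rV[R]_p) :
  (#|[pred i | (d 0 i != 0)%R]| <= \rank (diag_mx d))%N.
Proof.
set S := [pred i | d 0 i != 0].
(* [A] selects the coordinates in [S], and [B] embeds them back after division by the entries of
   [d]. The product with [diag_mx d] in between is an identity of size [#|S|], whose rank is at most
   that of the middle factor. *)
pose A := \matrix_(i < #|S|, j < p) (enum_val i == j)%:R : 'M[R]_(#|S|, p).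
pose B := \matrix_(j < p, i < #|S|) ((enum_val i == j)%:R / d 0 j) : 'M[R]_(p, #|S|).
rewrite -[X in (X <= _)%N](mxrank1 R).
suff <- : A *m diag_mx d *m B = 1%:M.
  exact: leq_trans (mxrankM_maxl _ _) (mxrankM_maxr _ _).
apply/matrixP => i k; rewrite mul_mx_diag !mxE (bigD1 (enum_val i)) //= big1 => [|j ji].
  rewrite addr0 !mxE eqxx mul1r (inj_eq enum_val_inj) eq_sym.
  have : enum_val i \in S by exact: enum_valP.
  by rewrite inE => di; rewrite mulrC mulfVK.
by rewrite !mxE eq_sym (negPf ji) !mul0r.
Qed.

(** Using the supremum in [specnorm] requires a nonempty set with an upper bound; the maximizer [u0]
    supplies both. *)
Lemma specnorm_attained (R : realType) m p (V : 'M[R]_(m, p)) (u0 : 'cV_p) :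
  fnorm u0 <= 1 ->
  (forall u : 'cV_p, fnorm u <= 1 -> fnorm (V *m u) <= fnorm (V *m u0)) ->
  specnorm V = fnorm (V *m u0).
Proof.
move=> u0_le1 h; apply/eqP; rewrite eq_le; apply/andP; split.
  apply: ge_sup; first by exists (fnorm (V *m u0)), u0.
  by move=> _ [u /= u1 <-]; exact: h.
apply: ub_le_sup; last by exists u0.
by exists (fnorm (V *m u0)) => _ [u /= u1 <-]; exact: h.
Qed.

(** In the coordinates [P^T *m u], [|V u|^2] is the sum of squares weighted by [d], and [|u|^2] is
    the unweighted sum. Hence each [d 0 i] is [|V P_i|^2], so nonnegative, and the largest one,
    [d 0 0], is the squared spectral norm, attained at the first column of [P]. *)
Lemma gram_spectral (R : realType) m n (V : 'M[R]_(m, n.+1)) (P : 'M[R]_n.+1) :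
  Ortho (V^T *m V) P ->
  [/\ P^T *m P = 1%:M, specnorm V = fnorm (V *m col 0 P),
      forall u : 'cV_n.+1, fnorm u <= 1 -> fnorm (V *m u) <= specnorm V &
      exists2 d : 'rV_n.+1,
        (forall i, 0 <= d 0 i <= specnorm V ^+ 2) /\ d 0 0 = specnorm V ^+ 2 &
        V^T *m V = P *m diag_mx d *m P^T].
Proof.
case=> PPT [d [d_sorted _] VVE].
have PTP : P^T *m P = 1%:M by exact: mulmx1C.
have quadE (u : 'cV_n.+1) : fnorm (V *m u) ^+ 2 = \sum_i d 0 i * (P^T *m u) i 0 ^+ 2.
  rewrite fnorm_sq inner_mull mulmxA VVE -mulmxA -mulmxA innerC inner_mull.
  rewrite innerE; apply: eq_bigr => i _; rewrite big_ord1 mul_diag_mx !mxE.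
  by rewrite expr2 mulrA.
have normE (u : 'cV_n.+1) : fnorm u ^+ 2 = \sum_i (P^T *m u) i 0 ^+ 2.
  rewrite fnorm_sq -{2}[u]mul1mx -PPT -mulmxA innerC inner_mull innerE.
  apply: eq_bigr => i _. by rewrite big_ord1 expr2.
have PTcol i : P^T *m col i P = delta_mx i 0.
  by rewrite colE mulmxA PTP mul1mx.
have col_sq i : fnorm (V *m col i P) ^+ 2 = d 0 i.
  rewrite quadE PTcol (bigD1 i) //= big1 => [|j ji].
    by rewrite !mxE !eqxx addr0 expr1n mulr1.
  by rewrite !mxE (negPf ji) /= expr0n mulr0.
have col1 : fnorm (col 0 P) = 1.
  apply/eqP; rewrite -sqrp_eq1 ?fnorm_ge0// normE PTcol (bigD1 0) //= big1 => [|j ji].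
    by rewrite !mxE !eqxx addr0 expr1n.
  by rewrite !mxE (negPf ji) /= expr0n.
have d_max (u : 'cV_n.+1) : fnorm u <= 1 -> fnorm (V *m u) <= fnorm (V *m col 0 P).
  move=> u1; rewrite -ler_sqr ?nnegrE ?fnorm_ge0// col_sq quadE.
  apply: (@le_trans _ _ (\sum_i d 0 0 * (P^T *m u) i 0 ^+ 2)).
    by apply: ler_sum => i _; rewrite ler_wpM2r ?sqr_ge0 ?d_sorted.
  rewrite -mulr_sumr -normE ler_piMr//; first by rewrite -col_sq sqr_ge0.
  by rewrite expr_le1 ?fnorm_ge0.
have specE : specnorm V = fnorm (V *m col 0 P).
  by apply: specnorm_attained => //; rewrite col1.
split=> //; first by move=> u /d_max; rewrite -specE.
exists d => //; rewrite specE col_sq; split=> // i.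
by apply/andP; split; [rewrite -col_sq sqr_ge0|exact: d_sorted].
Qed.

Lemma fnorm_col_orthogonal (R : realType) n (P : 'M[R]_n) j :
  P^T *m P = 1%:M -> fnorm (col j P) = 1.
Proof.
move=> PTP; apply/eqP.
by rewrite -sqrp_eq1 ?fnorm_ge0// -gram_diag PTP mxE eqxx.
Qed.

Lemma mxtrace_conj_orthogonal (R : realType) n (P A : 'M[R]_n) :
  P^T *m P = 1%:M -> \tr (P *m A *m P^T) = \tr A.
Proof. by move=> PTP; rewrite mxtrace_mulC mulmxA PTP mul1mx. Qed.

(** The left side is the trace of [V^T *m V], a sum of at most [\rank V] nonzero eigenvalues, each
    bounded by the largest one. *)
Lemma fnorm_sq_le_rank (R : realType) m n (V : 'M[R]_(m, n.+1)) P :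
  Ortho (V^T *m V) P -> fnorm V ^+ 2 <= (\rank V)%:R * specnorm V ^+ 2.
Proof.
move=> /gram_spectral[PTP _ _ [d [d_bd _] VVE]].
have rank_le : (#|[pred i | (d 0 i != 0)%R]| <= \rank V)%N.
  apply: leq_trans (rank_diag_ge d) _.
  have -> : diag_mx d = P^T *m (V^T *m V) *m P.
    by rewrite VVE !mulmxA PTP mul1mx -mulmxA PTP mulmx1.
  rewrite mulmxA -mulmxA; apply: leq_trans (mxrankM_maxr _ _) _.
  exact: mxrankM_maxl.
rewrite fnorm_sq /inner VVE mxtrace_conj_orthogonal// mxtrace_diag.
rewrite (bigID (fun i => d 0 i != 0)) /= [X in _ + X]big1 ?addr0; last first.
  by move=> i; rewrite negbK => /eqP.
apply: (@le_trans _ _ (\sum_(i | d 0 i != 0) specnorm V ^+ 2)).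
  by apply: ler_sum => i _; have /andP[] := d_bd i.
by rewrite sumr_const -[X in X <= _]mulr_natl ler_wpM2r ?sqr_ge0 ?ler_nat.
Qed.

Lemma sum_sqr_le (R : realType) (I : finType) (c : I -> R) :
  (forall i, 0 <= c i) -> \sum_i c i ^+ 2 <= (\sum_i c i) ^+ 2.
Proof.
move=> c_ge0; rewrite expr2 mulr_suml; apply: ler_sum => i _.
rewrite expr2 ler_wpM2l// (bigD1 i) //= lerDl.
by apply: sumr_ge0.
Qed.

(** Up to sign, the error is [P *m diag_mx c *m P^T], where [c] is [d] with its leading entry
    replaced by zero. Its Frobenius norm is the l2 norm of [c]; since [c] is nonnegative, this is at
    most the sum of its entries, which is [rank1_gap V]. *)
Lemma fnorm_rounding_gram (R : realType) m n (V : 'M[R]_(m, n.+1)) P :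
  Ortho (V^T *m V) P ->
  fnorm (rounding V P *m (rounding V P)^T - V^T *m V) <= rank1_gap V.
Proof.
move=> /gram_spectral[PTP _ _ [d [d_bd d0] VVE]].
pose c : 'rV_n.+1 := d - specnorm V ^+ 2 *: delta_mx 0 0.
have c_ge0 i : 0 <= c 0 i.
  rewrite /c !mxE eqxx /=; have [->|i_neq0] := eqVneq i 0.
    by rewrite d0 mulr1 subrr.
  by rewrite mulr0 subr0; have /andP[] := d_bd i.
have -> : rounding V P *m (rounding V P)^T - V^T *m V
    = - (P *m diag_mx c *m P^T).
  have -> : rounding V P *m (rounding V P)^T
      = P *m diag_mx (specnorm V ^+ 2 *: delta_mx 0 0) *m P^T.
    rewrite /rounding colE !linearZ /= -scalemxAl scalerA -expr2.
    rewrite trmx_mul trmx_delta -scalemxAl; congr (_ *: _).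
    rewrite !mulmxA; congr (_ *m _); rewrite -mulmxA; congr (_ *m _).
    rewrite mul_delta_mx; apply/matrixP => i j; rewrite !mxE eqxx /=.
    have [->|ij] := eqVneq i j; first by rewrite andbb.
    by have [i0|//] := eqVneq i 0; rewrite -i0 eq_sym (negPf ij).
  by rewrite VVE /c linearB /= mulmxBr mulmxBl opprB.
rewrite fnormN -ler_sqr ?nnegrE ?fnorm_ge0//; last first.
  rewrite /rank1_gap fnorm_sq /inner VVE mxtrace_conj_orthogonal// mxtrace_diag.
  rewrite (bigD1 0) //= d0 addrAC subrr add0r.
  by apply: sumr_ge0 => i _; have /andP[] := d_bd i.
have -> : rank1_gap V = \sum_i c 0 i.
  rewrite /rank1_gap fnorm_sq /inner VVE mxtrace_conj_orthogonal// mxtrace_diag.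
  rewrite (bigD1 0) //= [RHS](bigD1 0) //= /c !mxE !eqxx mulr1 d0 subrr add0r.
  rewrite addrAC subrr add0r; apply: eq_bigr => i i_neq0.
  by rewrite !mxE (negPf i_neq0) andbF mulr0 subr0.
rewrite fnorm_sq /inner !trmx_mul trmxK tr_diag_mx !mulmxA.
rewrite -(mulmxA _ P^T P) PTP mulmx1 -(mulmxA P) mxtrace_conj_orthogonal//.
rewrite mulmx_diag mxtrace_diag.
by under eq_bigr do rewrite mxE -expr2; exact: sum_sqr_le.
Qed.

(** For the leading unit eigenvector [u] of [V^T *m V], [|V|^2 = |V u|^2] while [|W|^2 >= |W u|^2].
    The difference of the two quadratic forms is an inner product with [u *m u^T], of Frobenius norm
    1. *)
Lemma specnorm_sq_sub_le (R : realType) m n (V W : 'M[R]_(m, n.+1)) P Q :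
  Ortho (V^T *m V) P -> Ortho (W^T *m W) Q ->
  specnorm V ^+ 2 - specnorm W ^+ 2 <= fnorm (V^T *m V - W^T *m W).
Proof.
move=> /gram_spectral[PTP sV _ _] /gram_spectral[_ _ sW _].
set u := col 0 P; have u1 : fnorm u = 1 by exact: fnorm_col_orthogonal.
have sW' : fnorm (W *m u) ^+ 2 <= specnorm W ^+ 2.
  have Wu : fnorm (W *m u) <= specnorm W by rewrite sW ?u1.
  by rewrite ler_sqr ?nnegrE ?fnorm_ge0 // (le_trans (fnorm_ge0 _) Wu).
apply: (le_trans (lerB (lexx _) sW')).
have -> : specnorm V ^+ 2 - fnorm (W *m u) ^+ 2
    = inner (V^T *m V - W^T *m W) (u *m u^T).
  rewrite -inner_mulr mulmxBl innerBl sV !fnorm_sq -!mulmxA.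
  by rewrite !inner_mull !trmxK.
apply: (le_trans (inner_le_fnorm _ _)).
suff -> : fnorm (u *m u^T) = 1 by rewrite mulr1.
have uu : u^T *m u = 1%:M.
  apply/matrixP => i j; rewrite !ord1 gram_diag !mxE eqxx.
  suff -> : col 0 u = u by rewrite u1 expr1n.
  by apply/matrixP => k l; rewrite mxE ord1.
apply/eqP; rewrite -sqrp_eq1 ?fnorm_ge0// fnorm_sq inner_mull mulmxA uu mul1mx.
by rewrite /inner trmxK mxtrace_mulC uu mxtrace1.
Qed.

(** * Passage to the limit in Gram matrices and on the sphere *)

Lemma cvg_gram (R : realType) m p (W : nat -> 'M[R]_(m, p)) (V : 'M[R]_(m, p)) :
  W k @[k --> \oo] --> V ->
  forall i j, ((W k)^T *m W k) i j @[k --> \oo] --> (V^T *m V) i j.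
Proof.
move=> WV i j.
have coordW a b : W k a b @[k --> \oo] --> V a b.
  
  apply: (@continuous_cvg _ _ _ _ _ _ (fun M : 'M[R]_(m, p) => M a b)) => //.
  exact: coord_continuous.
under eq_fun do rewrite mxE; rewrite mxE.
apply: cvg_big => [|a _]; first exact: add_continuous.
by under eq_fun do rewrite mxE; rewrite mxE; exact: cvgM.
Qed.

(** Convergence of matrices is used entrywise here: the squared Frobenius distance is a finite sum
    of squares of entries tending to 0. *)
Lemma cvg_fnorm_gram (R : realType) m p (W : nat -> 'M[R]_(m, p))
    (V : 'M[R]_(m, p)) :
  W k @[k --> \oo] --> V ->
  fnorm ((W k)^T *m W k - V^T *m V) @[k --> \oo] --> (0 : R).
Proof.
move=> /cvg_gram WV; rewrite -[X in _ --> X]sqrtr0.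
suff h : inner ((W k)^T *m W k - V^T *m V) ((W k)^T *m W k - V^T *m V)
    @[k --> \oo] --> (0 : R).
  exact: (continuous_cvg _ (@sqrt_continuous R 0) h).
rewrite [X in _ --> X](_ : 0 = \sum_(i < p) \sum_(j < p) 0); last first.
  by rewrite big1 // => i _; rewrite big1.
under eq_fun do rewrite innerE.
apply: cvg_big => [|i _]; first exact: add_continuous.
apply: cvg_big => [|j _]; first exact: add_continuous.
have entryE k : ((W k)^T *m W k - V^T *m V) i j
    = ((W k)^T *m W k) i j - (V^T *m V) i j by rewrite [LHS]mxE [X in _ + X]mxE.
have d0 : ((W k)^T *m W k) i j - (V^T *m V) i j @[k --> \oo] --> (0 : R).
  by rewrite -(subrr ((V^T *m V) i j)); apply: cvgB; [exact: WV|exact: cvg_cst].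
by under eq_fun do rewrite entryE; rewrite -(mulr0 0); exact: cvgM.
Qed.

Lemma sphere_closed (R : realType) m p (W : nat -> 'M[R]_(m, p))
    (V : 'M[R]_(m, p)) :
  W k @[k --> \oo] --> V -> (forall k, Sphere (W k)) -> Sphere V.
Proof.
move=> /cvg_gram WV sW; apply/sphere_diag => j.
have W1 k : ((W k)^T *m W k) j j = 1 by move/sphere_diag: (sW k).
have := WV j j; under eq_fun do rewrite W1.
by move=> h; apply: cvg_unique h _ => //; exact: cvg_cst.
Qed.

(** * Descent of the penalized objective along Algorithm A *)

Section AlgorithmA.
Variables (R : realType) (m n : nat).
Implicit Types (V W : 'M[R]_(m, n.+1)).

Lemma algorithmA_sphere (ft : 'M[R]_(m, n.+1) -> R) (Lft rho : R) V0 VV GG :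
  algorithmA ft Lft rho V0 VV GG -> forall k, Sphere (VV k).
Proof.
by case=> Llow [L [_ _ sV0 V0E run]] [|k]; [rewrite V0E|have [_ []] := run k].
Qed.

(* -2 V u u^T is a supergradient of the concave function -|.|^2 at V when u is
   a leading right singular vector of V. *)
Lemma specnorm_sq_linearization V W P Q :
  Ortho (V^T *m V) P -> Ortho (W^T *m W) Q ->
  specnorm V ^+ 2 - inner (- 2 *: (V *m col 0 P *m (col 0 P)^T)) (W - V)
    <= specnorm W ^+ 2.
Proof.
move=> /gram_spectral[PTP sV _ _] /gram_spectral[_ _ sW _].
set u := col 0 P; have u1 : fnorm u = 1 by exact: fnorm_col_orthogonal.
have Wu : fnorm (W *m u) <= specnorm W by rewrite sW ?u1.
apply: (@le_trans _ _ (fnorm (W *m u) ^+ 2)); last first.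
  by rewrite ler_sqr ?nnegrE ?fnorm_ge0 // (le_trans (fnorm_ge0 _) Wu).
rewrite innerZl inner_mulr trmxK mulmxBl innerBr sV !fnorm_sq.
(* Convexity of the square: [|W u|^2 >= |V u|^2 + 2 <V u, W u - V u>]. *)
have := inner_ge0 (W *m u - V *m u).
rewrite innerBl !innerBr (innerC (W *m u) (V *m u)). lra.
Qed.

Lemma algorithmA_descent (ft : 'M[R]_(m, n.+1) -> R) (Lft rho : R) V0 VV GG :
  0 <= rho ->
  (forall V Z, Sphere V -> Sphere Z ->
     `|ft V - ft Z - inner (grad ft Z) (V - Z)|
       <= Lft / 2 * fnorm (V - Z) ^+ 2) ->
  algorithmA ft Lft rho V0 VV GG ->
  forall k, ft (VV k) - rho * specnorm (VV k) ^+ 2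
            <= ft V0 - rho * specnorm V0 ^+ 2.
Proof.
move=> rho_ge0 descent runA.
have sphereV := algorithmA_sphere runA.
case: runA => Llow [L [Lft_lt L_bd _ V0E run]].
elim=> [|k IHk]; first by rewrite V0E.
apply: le_trans IHk.
(* Minimality of [VV k.+1] is tested against the competitor [VV k], for which the proximal term
   vanishes; the terms in [fnorm _ ^+ 2] scaled by [rho] are equal on the sphere and cancel. *)
have [[P PV ->] [_ /(_ _ (sphereV k))]] := run k.
have [[Q QV _] _] := run k.+1.
have := specnorm_sq_linearization PV QV.
set G := - 2 *: _ => lin.
rewrite /= (sphere_fnorm (sphereV k.+1)) (sphere_fnorm (sphereV k)) subrr.
rewrite fnorm0 expr0n mulr0 addr0 !innerDl !(innerZl rho) => opt.
have := descent _ _ (sphereV k.+1) (sphereV k).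
rewrite ler_norml => /andP[_].
move: opt lin; rewrite !innerBr.
have /andP[L_ge _] := L_bd k.
have := sqr_ge0 (fnorm (VV k.+1 - VV k)).
set D := fnorm _ ^+ 2; set g := inner (grad _ _) _; set g' := inner (grad _ _) _.
set h := inner G _; set h' := inner G _ => D_ge0 opt lin.
(* Since [L k > Lft], the proximal term absorbs the quadratic remainder of the descent
   inequality. *)
have LD : Lft / 2 * D <= L k / 2 * D by rewrite ler_wpM2r//; lra.
have := ler_wpM2l rho_ge0 lin.
move: opt LD; rewrite !mulrBr; lra.
Qed.

End AlgorithmA.

(** Replacing [VV k] by its limit costs at most [(alpha + rho)] times the distance of the Gram
    matrices: [alpha] from [f], and [rho] from the squared spectral norm, which is 1-Lipschitz in
    the Gram matrix. This distance tends to 0. *)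
Lemma algorithmA_limit_descent (R : realType) m n (f : 'M[R]_n.+1 -> R)
    (alpha Lft rho : R) (V0 V : 'M[R]_(m, n.+1)) VV GG P :
  0 <= alpha -> lipschitz_scalar alpha (@Omega R n.+1) f -> 0 <= rho ->
  (forall V Z : 'M[R]_(m, n.+1), Sphere V -> Sphere Z ->
     `|factored f V - factored f Z - inner (grad (factored f) Z) (V - Z)|
       <= Lft / 2 * fnorm (V - Z) ^+ 2) ->
  algorithmA (factored f) Lft rho V0 VV GG ->
  VV k @[k --> \oo] --> V -> Ortho (V^T *m V) P ->
  factored f V - rho * specnorm V ^+ 2
    <= factored f V0 - rho * specnorm V0 ^+ 2.
Proof.
move=> alpha_ge0 f_lip rho_ge0 descent runA VV_V PV.
have sphereVV := algorithmA_sphere runA.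
have sphereV := sphere_closed VV_V sphereVV.
set c := factored f V0 - _.
pose e k := fnorm ((VV k)^T *m VV k - V^T *m V).
have le_e k : factored f V - rho * specnorm V ^+ 2 <= c + (alpha + rho) * e k.
  have [Llow [L [_ _ _ _ run]]] := runA.
  have [[Q QV _] _] := run k.
  have := ler_wpM2l rho_ge0 (specnorm_sq_sub_le QV PV).
  have := algorithmA_descent rho_ge0 descent runA k.
  have := f_lip _ _ (sphere_Omega (sphereVV k)) (sphere_Omega sphereV).
  rewrite ler_norml => /andP[+ _].
  rewrite -/(e k) -/c -/(factored f V) -/(factored f (VV k)) !mulrBr; lra.
have e_cvg : c + (alpha + rho) * e k @[k --> \oo] --> c.
  rewrite -[X in _ --> X]addr0 -[X in _ --> _ + X](mulr0 (alpha + rho)).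
  apply: cvgD; first exact: cvg_cst.
  by apply: cvgM; [exact: cvg_cst|exact: cvg_fnorm_gram].
apply: (ler_cvg_to (cvg_cst _) e_cvg).
by apply: nearW.
Qed.

(** * Penalty parameters, summation over the passes and the final bounds *)

Lemma penalties_gt0 (R : realType) (rho0 sigma rhomax : R) rho :
  0 < rho0 -> 0 < sigma -> 0 < rhomax -> penalties rho0 sigma rhomax rho ->
  forall l, 0 < rho l.
Proof.
move=> rho0_gt0 sigma_gt0 rhomax_gt0 [rho_0 rho_S].
elim=> [|l IHl]; first by rewrite rho_0.
by rewrite rho_S lt_min rhomax_gt0 mulr_gt0.
Qed.

(* Summation by parts of F j.+1 - F j <= rho j * (s j.+1 - s j). *)
Lemma sum_penalized_descent (R : realDomainType) (rho F s : nat -> R) a b :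
  (a <= b)%N ->
  (forall j, (a <= j < b)%N ->
     F j.+1 - rho j * s j.+1 <= F j - rho j * s j) ->
  F b - F a <= rho b * s b - rho a * s a
               + \sum_(a <= j < b) (rho j - rho j.+1) * s j.+1.
Proof.
move=> ab h; pose G j := F j - rho j * s j.
(* Changing [rho j] into [rho j.+1] in the descent inequality contributes exactly
   [(rho j - rho j.+1) * s j.+1], and the left side telescopes. *)
have : \sum_(a <= j < b) (G j.+1 - G j)
    <= \sum_(a <= j < b) (rho j - rho j.+1) * s j.+1.
  by apply: ler_sum_nat => j /h; rewrite /G mulrBl; lra.
by rewrite telescope_sumr// /G; lra.
Qed.

Lemma sphere_card_div_rank_le (R : realType) m n (V : 'M[R]_(m, n.+1)) P :
  Sphere V -> Ortho (V^T *m V) P ->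
  n.+1%:R / (\rank V)%:R <= specnorm V ^+ 2.
Proof.
move=> sV /fnorm_sq_le_rank; rewrite (sphere_fnorm sV).
(* In rank 0 the quotient is 0 by the convention [0^-1 = 0]. *)
have [->|r_gt0] := posnP (\rank V); first by rewrite invr0 mulr0 sqr_ge0.
by rewrite ler_pdivrMr ?ltr0n// mulrC.
Qed.

(** As [V^T *m V] has unit diagonal, the vector on the left is the diagonal of the matrix on the
    right. *)
Lemma fnorm_square_sub1_le (R : realType) m n (V : 'M[R]_(m, n)) (x : 'cV_n) :
  Sphere V ->
  fnorm (map2_mx *%R x x - const_mx 1) <= fnorm (x *m x^T - V^T *m V).
Proof.
move=> /sphere_diag sV; rewrite -ler_sqr ?nnegrE ?fnorm_ge0// !fnorm_sq !innerE.
apply: ler_sum => i _; rewrite big_ord1.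
have -> : (map2_mx *%R x x - const_mx 1) i 0 = (x *m x^T - V^T *m V) i i.
  rewrite [RHS]mxE [X in _ = _ + X]mxE sV [X in _ = X + _]mxE big_ord1.
  by rewrite !mxE.
rewrite (bigD1 i) //= lerDl; apply: sumr_ge0 => j _.
by rewrite -expr2 sqr_ge0.
Qed.

Unset Implicit Arguments.

Theorem theorem2 (R : realType) (m n : nat) (hmp : (1 < m < n.+1)%N)
    (f : 'M[R]_n.+1 -> R)
    (f_smooth : smooth_on_sym f)
    (f_grad_lipschitz : exists (B : set 'M[R]_n.+1) (L : R),
       [/\ B `<=` @Sym R n.+1, compact B,
           contains_extrapolations B (@Omega R n.+1) &
           lipschitz_mx L B (grad (on_sym f))])
    (alpha : R) (alpha_gt0 : 0 < alpha)
    (f_lipschitz :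
       lipschitz_scalar alpha (@Omega R n.+1 `|` @Rounded R m n) f)
    (BS : set 'M[R]_(m, n.+1)) (BS_compact : compact BS)
    (BS_contains : contains_extrapolations BS (@Sphere R m n.+1))
    (Lft : R) (Lft_gt0 : 0 < Lft)
    (ft_grad_lipschitz : lipschitz_mx Lft BS (grad (@factored R m n.+1 f)))
    (ft_descent : forall V Z : 'M[R]_(m, n.+1), BS V -> BS Z ->
       `|factored f V - factored f Z - inner (grad (factored f) Z) (V - Z)|
         <= Lft / 2 * fnorm (V - Z) ^+ 2)
    (eps rhomax rho0 sigma : R) (lmax : nat)
    (eps_bounds : 0 < eps < 1) (rhomax_gt0 : 0 < rhomax)
    (rho0_gt0 : 0 < rho0) (sigma_gt1 : 1 < sigma)
    (rho : nat -> R) (rho_penalties : penalties rho0 sigma rhomax rho)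
    (V : nat -> 'M[R]_(m, n.+1)) (VV GG : nat -> nat -> 'M[R]_(m, n.+1))
    (lf : nat)
    (run : algorithm1_normal (factored f) Lft eps lmax rho V VV GG lf)
    (vstar : R)
    (vstar_attained : exists2 X, @Feas R n.+1 X & f X = vstar)
    (vstar_lower : forall X, @Feas R n.+1 X -> vstar <= f X)
    (ls : nat) (ls_le : (ls <= lf)%N)
    (ls_value : f ((V ls)^T *m V ls) <= vstar)
    (P : 'M[R]_n.+1) (hP : Ortho ((V lf)^T *m V lf) P) :
  let x := rounding (V lf) P in
  f (x *m x^T) - vstar
    <= rho lf * specnorm (V lf) ^+ 2
       - rho ls * (n.+1%:R / (\rank (V ls))%:R)
       + \sum_(ls <= j < lf) (rho j - rho j.+1) * specnorm (V j.+1) ^+ 2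
       + alpha * eps
  /\ fnorm (map2_mx *%R x x - const_mx 1) <= eps.

Proof.
have [/andP[lf_gt0 _] sphereV0 pass _ gap_le] := run.
have rho_gt0 := penalties_gt0 rho0_gt0 (lt_trans ltr01 sigma_gt1) rhomax_gt0
  rho_penalties.
(* The extrapolation with [tau = 0] is the point itself. *)
have BS_sphere W : Sphere W -> BS W.
  move=> sW; have := @BS_contains 0 W W.
  by rewrite addr0 scale1r scale0r subr0; apply; rewrite ?lexx ?ler01.
have descent W Z : Sphere W -> Sphere Z -> _ :=
  fun sW sZ => ft_descent W Z (BS_sphere W sW) (BS_sphere Z sZ).
have sphereV l : (l <= lf)%N -> Sphere (V l).
  case: l => [//|l] l_lt; have [runA VV_V] := pass l l_lt.
  exact: sphere_closed VV_V (algorithmA_sphere runA).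
(* The spectral decomposition at V l is the one chosen in the first step of
   pass l. *)
have orthoV l : (l <= lf)%N -> exists Q, Ortho ((V l)^T *m V l) Q.
  rewrite leq_eqVlt => /predU1P[->|l_lt]; first by exists P.
  have [[Llow [L [_ _ _ V0E steps]]] _] := pass l l_lt.
  by have [[Q QV _] _] := steps 0%N; exists Q; rewrite -V0E.
have f_lip : lipschitz_scalar alpha (@Omega R n.+1) f.
  by move=> X Y hX hY; apply: f_lipschitz; left.
have step l : (ls <= l < lf)%N ->
    factored f (V l.+1) - rho l * specnorm (V l.+1) ^+ 2
      <= factored f (V l) - rho l * specnorm (V l) ^+ 2.
  move=> /andP[_ l_lt]; have [runA VV_V] := pass l l_lt.
  have [Q QV] := orthoV l.+1 l_lt.
  exact: (algorithmA_limit_descent (ltW alpha_gt0) f_lip (ltW (rho_gt0 l))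
            descent runA VV_V QV).
(* The stopping test bounds the rounding error by [eps]; this serves both the objective and the
   constraint estimate. *)
have round_le := le_trans (fnorm_rounding_gram hP) gap_le.
move=> x; split; last first.
  exact: le_trans (fnorm_square_sub1_le _ (sphereV lf (leqnn lf))) round_le.
have [Q QV] := orthoV ls ls_le.
have := ler_wpM2l (ltW (rho_gt0 ls)) (sphere_card_div_rank_le (sphereV ls ls_le) QV).
have := sum_penalized_descent ls_le step.
(* The Lipschitz bound compares a point of [Rounded] with a point of [Omega]. *)
have : f (x *m x^T) - factored f (V lf) <= alpha * eps.
  apply: le_trans (ler_norm _) _.
  apply: le_trans (f_lipschitz _ _ _ _) _; last by rewrite ler_wpM2l// ltW.
    by right; exists (V lf), P; split=> //; exact: sphereV.
  by left; apply: sphere_Omega; exact: sphereV.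
(* The gap splits into the rounding error, the change of [factored f] from [V ls] to [V lf], and
   [factored f (V ls) - vstar <= 0]. *)
move: ls_value; rewrite -/(factored f (V ls)); lra.
Qed.
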